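(* Let $H$ be an invertible $n\times n$ real Hankel matrix and let $\mathbf{u}=(u_1,\ldots,u_{n+1})^T\in\mathbb{R}^{n+1}$ be a vector with $u_1\neq 0$ and $u_{n+1}\neq 0$. Let $C_t,C_b$ be the top and bottom companion matrices of $\mathbf{u}$, and let $\overline{C}_l,\overline{C}_r$ be the left and right companion matrices of the reversed vector $\mathbf{u}^J=(u_{n+1},u_n,\ldots,u_1)^T$. Then the following statements are equivalent. 1. $\mathbf{u}^J\in\operatorname{Ker}(\partial H)$. 2. Both $C_tH$ and $H\overline{C}_l$ are Hankel matrices and $C_tH=H\overline{C}_l$. 3. Both $C_bH$ and $H\overline{C}_r$ are Hankel matrices and $C_bH=H\overline{C}_r$. Furthermore, when these equivalent conditions hold, $H^{-1}C_t^kH=\overline{C}_l^{\,k}$ for all integers $k$.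
   Context: For a vector $\mathbf{w}=(w_1,\ldots,w_{n+1})^T\in\mathbb{R}^{n+1}$ with $w_1,w_{n+1}\neq 0$, the companion matrices of $\mathbf{w}$ are the following $n\times n$ matrices (all nonsingular). $C_t(\mathbf{w})$: first row $\left(-\frac{w_n}{w_{n+1}},-\frac{w_{n-1}}{w_{n+1}},\ldots,-\frac{w_1}{w_{n+1}}\right)$; rows $2,\ldots,n$ are $[\,I_{n-1}\;\;0\,]$. $C_b(\mathbf{w})$: rows $1,\ldots,n-1$ are $[\,0\;\;I_{n-1}\,]$; last row $\left(-\frac{w_{n+1}}{w_1},-\frac{w_n}{w_1},\ldots,-\frac{w_2}{w_1}\right)$. $C_l(\mathbf{w})$: first column $\left(-\frac{w_2}{w_1},\ldots,-\frac{w_{n+1}}{w_1}\right)^T$; columns $2,\ldots,n$ are $\begin{bmatrix} I_{n-1}\\ 0\end{bmatrix}$. $C_r(\mathbf{w})$: columns $1,\ldots,n-1$ are $\begin{bmatrix}0\\ I_{n-1}\end{bmatrix}$; last column $\left(-\frac{w_1}{w_{n+1}},\ldots,-\frac{w_n}{w_{n+1}}\right)^T$. Write $C_t=C_t(\mathbf{u})$, $C_b=C_b(\mathbf{u})$, $\overline{C}_l=C_l(\mathbf{u}^J)$, $\overline{C}_r=C_r(\mathbf{u}^J)$, where $\mathbf{u}^J=(u_{n+1},u_n,\ldots,u_1)^T$. For an $n\times n$ Hankel matrix $H$ with entries $H_{ij}=a_{i+j-n-1}$ (indices running from $1-n$ to $n-1$), $\partial H$ is the $(n-1)\times(n+1)$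 Hankel matrix with entries $(\partial H)_{ij}=a_{i+j-n-1}$, $1\le i\le n-1$, $1\le j\le n+1$; that is, one column is added on the right of $H$ preserving the Hankel structure and then the last row is deleted. *)

(* Defs.v *)
From HB Require Import structures.
From mathcomp Require Import all_boot all_order all_algebra.
From mathcomp Require Import reals.

Set Implicit Arguments.
Unset Strict Implicit.
Unset Printing Implicit Defensive.

Import GRing.Theory.
Local Open Scope ring_scope.

(* The matrices have size n.+1, so that 'M_n.+1 is a ring with inverses and
   integer powers, and the vectors have length n.+2. Indices start at 0: the
   entry of row i and column j below is that of row i+1 and column j+1, and
   w_k is [w (inord (k - 1)) 0], in the usual numbering. *)

(* For size N = n+1, a_((i+1) + (j+1) - N - 1) = a_(i + j - n). *)
Definition hankel (R : fieldType) (n : nat) (a : int -> R) : 'M[R]_n.+1 :=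
  \matrix_(i, j) a (i%:Z + j%:Z - n%:Z).

Definition is_hankel (R : fieldType) (n : nat) (A : 'M[R]_n.+1) : Prop :=
  exists a : int -> R, A = hankel n a.

(* The matrix ∂H for H = hankel n a. Its indices i + j - n lie between -n and
   n, so it depends on a only through H. *)
Definition dhankel (R : fieldType) (n : nat) (a : int -> R) :
    'M[R]_(n, n.+2) :=
  \matrix_(i, j) a (i%:Z + j%:Z - n%:Z).

Definition revcol (R : fieldType) (m : nat) (w : 'cV[R]_m) : 'cV[R]_m :=
  \col_i w (rev_ord i) 0.

Section Companion.
Variables (R : fieldType) (n : nat) (w : 'cV[R]_n.+2).

Definition comp_top : 'M[R]_n.+1 :=
  \matrix_(i, j) if i == ord0 then - (w (inord (n - j)) 0 / w ord_max 0)
                 else (i == j.+1 :> nat)%:R.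

Definition comp_bottom : 'M[R]_n.+1 :=
  \matrix_(i, j) if i == ord_max then - (w (inord (n.+1 - j)) 0 / w ord0 0)
                 else (j == i.+1 :> nat)%:R.

Definition comp_left : 'M[R]_n.+1 :=
  \matrix_(i, j) if j == ord0 then - (w (inord i.+1) 0 / w ord0 0)
                 else (j == i.+1 :> nat)%:R.

Definition comp_right : 'M[R]_n.+1 :=
  \matrix_(i, j) if j == ord_max then - (w (inord i) 0 / w ord_max 0)
                 else (i == j.+1 :> nat)%:R.

End Companion.

(* Main.v *)
Require Import Defs.
From HB Require Import structures.
From mathcomp Require Import all_boot all_order all_algebra.
From mathcomp Require Import reals zify ring.

Set Implicit Arguments.
Unset Strict Implicit.
Unset Printing Implicit Defensive.

Import GRing.Theory.
Local Open Scope ring_scope.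

(** Write [defect] for the vector [dhankel n a *m revcol u].

    The shift rows of [comp_top u] copy all rows but the last of [H] one row
    down, and the shift rows of [comp_bottom u] copy all rows but the first
    one row up.  So each product is already constant along antidiagonals
    outside its one remaining row (the first, resp. the last), which has a
    corner entry alone on its antidiagonal and [n] other entries, whose values
    are forced by the neighbouring row.  The companion coefficients are those
    of [revcol u], negated and divided by one of its end entries, so the [k]-th of these
    entries misses its forced value by exactly [defect k 0 / u ord_max 0],
    resp. [defect k 0 / u ord0 0] ([comp_top_mul_hankel],
    [comp_bottom_mul_hankel]).  Either product is therefore Hankel if and only
    if [defect = 0].

    The left and right companion matrices of the reversed vector are the
    transposes of the top and bottom ones of [u].  As Hankel matrices are
    symmetric, [H *m C^T] is the transpose of [C *m H]: once [C *m H] is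
    Hankel, so is [H *m C^T], and the two are equal ([hankel_mul_trP]).

    Finally [Ct *m H = H *m Cl] says that the invertible [H] intertwines [Ct]
    and [Cl]; it then intertwines all their integer powers. *)

Section Hankel.
Variables (R : fieldType) (n : nat).
Implicit Types (A C : 'M[R]_n.+1) (a : int -> R).

Lemma is_hankel_antidiag A (i j k l : 'I_n.+1) :
  is_hankel A -> (i + j = k + l)%N -> A i j = A k l.
Proof. by case=> a -> ijkl; rewrite !mxE -!PoszD ijkl. Qed.

Lemma is_hankel_sym A : is_hankel A -> A^T = A.
Proof.
move=> hA; apply/matrixP=> i j; rewrite mxE.
exact: is_hankel_antidiag (addnC _ _).
Qed.

(** Transposing [C *m A] gives [A *m C^T] since [A] is symmetric, and a Hankel
    product is its own transpose. *)
Lemma hankel_mul_trP A C : is_hankel A ->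
  is_hankel (C *m A) <->
  [/\ is_hankel (C *m A), is_hankel (A *m C^T) & C *m A = A *m C^T].
Proof.
move=> hA; split=> [hCA | [] //].
have <- : C *m A = A *m C^T.
  by rewrite -{1}(is_hankel_sym hCA) trmx_mul (is_hankel_sym hA).
by split.
Qed.

End Hankel.

(** Either [x] and its conjugate [y] are both units, and the relation can be
    multiplied by their inverses, or neither is a unit, and both are their own
    inverses by convention. *)
Lemma intertwine_inv (S : unitRingType) (h x y : S) :
  h \is a GRing.unit -> x * h = h * y -> x^-1 * h = h * y^-1.
Proof.
move=> hU xh.
have Uxy : (x \is a GRing.unit) = (y \is a GRing.unit).
  by rewrite -(unitrMl x hU) xh unitrMr.
case: (boolP (x \is a GRing.unit)) => xU; last first.
  by rewrite !invr_out -?Uxy.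
by apply: (mulrI xU); rewrite mulVKr // mulrA xh -mulrA divrr ?mulr1 // -Uxy.
Qed.

Lemma intertwine_exprz (S : unitRingType) (h x y : S) (k : int) :
  h \is a GRing.unit -> x * h = h * y -> h^-1 * x ^ k * h = y ^ k.
Proof.
move=> hU xh.
have pow m : x ^+ m * h = h * y ^+ m.
  elim: m => [|m IHm]; first by rewrite !expr0 mul1r mulr1.
  by rewrite exprS -mulrA IHm mulrA xh -mulrA -exprS.
rewrite -mulrA; suff -> : x ^ k * h = h * y ^ k by rewrite mulKr.
by case: k => m; [exact: pow | apply: intertwine_inv hU (pow _)].
Qed.

Section CompanionHankel.
Variables (R : fieldType) (n : nat) (a : int -> R) (u : 'cV[R]_n.+2).

Local Notation H := (hankel n a).
Local Notation defect := (dhankel n a *m revcol u).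

Let rev_first : rev_ord ord0 = ord_max :> 'I_n.+2.
Proof. by apply: val_inj; rewrite /= subn1. Qed.

Let rev_last : rev_ord ord_max = ord0 :> 'I_n.+2.
Proof. by apply: val_inj; rewrite /= subnn. Qed.

Lemma comp_left_rev : comp_left (revcol u) = (comp_top u)^T.
Proof.
apply/matrixP=> i j; rewrite !mxE rev_first; case: ifP => // _.
congr (- (u _ _ / _)); apply: val_inj.
by rewrite /= !inordK //; have := ltn_ord i; lia.
Qed.

Lemma comp_right_rev : comp_right (revcol u) = (comp_bottom u)^T.
Proof.
apply/matrixP=> i j; rewrite !mxE rev_last; case: ifP => // _.
congr (- (u _ _ / _)); apply: val_inj.
by rewrite /= !inordK //; have := ltn_ord i; lia.
Qed.

Lemma comp_top_mul_shift (i j : 'I_n.+1) : i != ord0 ->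
  (comp_top u *m H) i j = a (i%:Z + j%:Z - n%:Z - 1).
Proof.
move=> i0; have i_gt0 : (0 < i)%N by rewrite lt0n.
rewrite mxE (bigD1 (inord i.-1)) //= big1 => [|k ki].
  rewrite !mxE (negPf i0) inordK; last by have := ltn_ord i; lia.
  by rewrite prednK // eqxx mul1r addr0; congr a; lia.
rewrite !mxE (negPf i0); case: eqP => [ik|]; last by rewrite mul0r.
by case/eqP: ki; apply: val_inj; rewrite /= ik /= inordK.
Qed.

Lemma comp_bottom_mul_shift (i j : 'I_n.+1) : i != ord_max ->
  (comp_bottom u *m H) i j = a (i%:Z + j%:Z - n%:Z + 1).
Proof.
move=> imax; have i_lt : (i.+1 < n.+1)%N.
  by move: imax; rewrite -val_eqE /=; have := ltn_ord i; lia.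
rewrite mxE (bigD1 (inord i.+1)) //= big1 => [|k ki].
  rewrite !mxE (negPf imax) inordK // eqxx mul1r addr0; congr a; lia.
rewrite !mxE (negPf imax); case: eqP => [ik|]; last by rewrite mul0r.
by case/eqP: ki; apply: val_inj; rewrite /= inordK -ik.
Qed.

(** Apart from the factor [- (u ord_max 0)^-1], the companion row lists the
    entries of [revcol u] after the first, so the product is the [k]-th
    relation [defect k 0] with its first term [u ord_max 0 * a (k - n)] taken
    out. *)
Lemma comp_top_mul_hankel (k : 'I_n) : u ord_max 0 != 0 ->
  (comp_top u *m H) ord0 (lift ord0 k)
  = a (k%:Z - n%:Z) - defect k 0 / u ord_max 0.
Proof.
move=> u0; rewrite !mxE [in RHS]big_ord_recl !mxE /= rev_first addr0.
rewrite mulrDl mulfK // opprD addrA subrr add0r mulr_suml -sumrN.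
apply: eq_bigr => j _; rewrite !mxE /=.
have -> : rev_ord (lift ord0 j) = inord (n - j) :> 'I_n.+2.
  by apply: val_inj; rewrite /= inordK; have := ltn_ord j; rewrite /bump; lia.
have -> : j%:Z + (bump 0 k)%:Z - n%:Z = k%:Z + (bump 0 j)%:Z - n%:Z.
  by rewrite /bump; lia.
by ring.
Qed.

(** Here the companion row lists the entries of [revcol u] before the last, so
    the term taken out of [defect k 0] is the last one. *)
Lemma comp_bottom_mul_hankel (k : 'I_n) : u ord0 0 != 0 ->
  (comp_bottom u *m H) ord_max (lift ord_max k)
  = a (k%:Z + 1) - defect k 0 / u ord0 0.
Proof.
move=> u0; rewrite !mxE [in RHS]big_ord_recr !mxE /= rev_last.
have -> : k%:Z + n.+1%:Z - n%:Z = k%:Z + 1 by lia.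
rewrite mulrDl mulfK // opprD addrCA subrr addr0 mulr_suml -sumrN.
apply: eq_bigr => j _; rewrite !mxE eqxx.
have -> : rev_ord (widen_ord (leqnSn n.+1) j) = inord (n.+1 - j) :> 'I_n.+2.
  by apply: val_inj; rewrite /= inordK; have := ltn_ord j; lia.
have -> : j%:Z + (lift ord_max k)%:Z - n%:Z = k%:Z + j%:Z - n%:Z.
  by rewrite lift_max (addrC j%:Z).
by rewrite /=; ring.
Qed.

Lemma comp_top_hankelP : u ord_max 0 != 0 ->
  is_hankel (comp_top u *m H) <-> defect = 0.
Proof.
move=> u0; split=> [hCH | d0].
  apply/matrixP=> k j; rewrite ord1 [RHS]mxE.
  have := comp_top_mul_hankel k u0.
  rewrite (is_hankel_antidiag (k := lift ord0 k) (l := ord0) hCH) ?addn0 //.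
  rewrite comp_top_mul_shift //.
  have -> : (lift ord0 k)%:Z + (@ord0 n)%:Z - n%:Z - 1 = k%:Z - n%:Z.
    by rewrite /= /bump; lia.
  move=> /eqP; rewrite -subr_eq0 opprD addrA subrr add0r opprK mulf_eq0.
  by rewrite invr_eq0 (negPf u0) orbF => /eqP.
(* The index [- n] occurs only at the top left corner, whose entry is
   unconstrained; elsewhere the product is [H] shifted by one. *)
exists (fun m => if m == - n%:Z then (comp_top u *m H) ord0 ord0
                 else a (m - 1)).
apply/matrixP=> i j; rewrite [RHS]mxE.
have [-> | i0] := eqVneq i ord0; last first.
  rewrite (comp_top_mul_shift _ i0) /= ifN //; move: i0.
  by rewrite -val_eqE /=; lia.
case: (unliftP ord0 j) => [k|] -> /=; last by rewrite ifT //; lia.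
rewrite ifN; last by rewrite /bump; lia.
rewrite comp_top_mul_hankel // d0 mxE mul0r subr0; congr a; rewrite /bump; lia.
Qed.

Lemma comp_bottom_hankelP : u ord0 0 != 0 ->
  is_hankel (comp_bottom u *m H) <-> defect = 0.
Proof.
move=> u0; split=> [hCH | d0].
  apply/matrixP=> k j; rewrite ord1 [RHS]mxE.
  have := comp_bottom_mul_hankel k u0.
  rewrite (is_hankel_antidiag (l := ord_max) hCH (addnC _ _)).
  rewrite comp_bottom_mul_shift; last by rewrite eq_sym neq_lift.
  have -> : (lift ord_max k)%:Z + (@ord_max n)%:Z - n%:Z + 1 = k%:Z + 1.
    by rewrite lift_max /=; lia.
  move=> /eqP; rewrite -subr_eq0 opprD addrA subrr add0r opprK mulf_eq0.
  by rewrite invr_eq0 (negPf u0) orbF => /eqP.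
(* The index [n] occurs only at the bottom right corner, whose entry is
   unconstrained; elsewhere the product is [H] shifted by one. *)
exists (fun m => if m == n%:Z then (comp_bottom u *m H) ord_max ord_max
                 else a (m + 1)).
apply/matrixP=> i j; rewrite [RHS]mxE.
have [-> | imax] := eqVneq i ord_max; last first.
  rewrite (comp_bottom_mul_shift _ imax) /= ifN //; move: imax.
  by rewrite -val_eqE /=; have := ltn_ord i; have := ltn_ord j; lia.
case: (unliftP ord_max j) => [k|] ->; last by rewrite /= addrK eqxx.
rewrite lift_max ifN /=; last by have := ltn_ord k => /=; lia.
rewrite comp_bottom_mul_hankel // d0 mxE mul0r subr0; congr a => /=; lia.
Qed.

End CompanionHankel.

Theorem corollary2p2 (R : realType) (n : nat) (a : int -> R)
    (H : 'M[R]_n.+1) (u : 'cV[R]_n.+2)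
    (H_hankel : H = hankel n a)
    (H_unit : H \in unitmx)
    (u_first : u ord0 0 != 0)
    (u_last : u ord_max 0 != 0) :
  let uJ := revcol u in
  let Ct := comp_top u in
  let Cb := comp_bottom u in
  let Cl := comp_left uJ in
  let Cr := comp_right uJ in
  let cond1 := dhankel n a *m uJ = 0 in
  let cond2 := [/\ is_hankel (Ct *m H), is_hankel (H *m Cl)
                 & Ct *m H = H *m Cl] in
  let cond3 := [/\ is_hankel (Cb *m H), is_hankel (H *m Cr)
                 & Cb *m H = H *m Cr] in
  [/\ cond1 <-> cond2,
      cond1 <-> cond3
    & cond1 -> forall k : int, invmx H *m (Ct ^ k) *m H = Cl ^ k].
Proof.
move=> uJ Ct Cb Cl Cr cond1 cond2 cond3.
have hH : is_hankel H by exists a.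
have cond12 : cond1 <-> cond2.
  rewrite /cond1 /cond2 /Cl comp_left_rev -hankel_mul_trP // /Ct H_hankel.
  by rewrite comp_top_hankelP.
split=> //.
  rewrite /cond1 /cond3 /Cr comp_right_rev -hankel_mul_trP // /Cb H_hankel.
  by rewrite comp_bottom_hankelP.
by move=> /cond12 [_ _ CtH] k; apply: intertwine_exprz H_unit CtH.
Qed.
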